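(* Let $P$ be the poset of join-irreducible elements of a finite distributive lattice $H$, let $\epsilon\in\{1,-1\}$, and let $y_0,x_1,\ldots,y_{t-1},x_t$ be a $q^{(\epsilon)}$-reduced sequence with condition N. Then $$\dim C^{(\epsilon)}=\#(P\setminus G)+t ,$$ where $C^{(\epsilon)}$ and $G$ are the polytope and the set associated with this sequence.
   Context: Let $x_0$ be the least element of $H$ and $P=\{\alpha\in H: \alpha=\beta\vee\gamma\Rightarrow\alpha=\beta\text{ or }\alpha=\gamma\}$ (so $x_0\in P$ is the least element of $P$). Let $P^+=P\cup\{\infty\}$ with $x<\infty$ for all $x\in P$; $x\lessdot y$ means $y$ covers $x$; $[x,y]_{P^+}=\{z\in P^+\mid x\le z\le y\}$. For $x\le y$ in $P^+$ and $n\in\mathbb Z$, $q^{(n)}\mathrm{dist}(x,y)=\max\{nt\mid\text{there is a saturated chain }x=z_0\lessdot z_1\lessdot\cdots\lessdot z_t=y\}$. For $w_0<z_0>w_1<z_1>\cdots>w_\ell<z_\ell$ in $P^+$, $q^{(n)}(w_0,z_0,\ldots,w_\ell,z_\ell)=\sum_{i=0}^\ell q^{(n)}\mathrm{dist}(w_i,z_i)-\sum_{i=1}^\ell q^{(n)}\mathrm{dist}(w_i,z_{i-1})$. A (possibly empty, $t=0$) sequence $y_0,x_1,y_1,x_2,\ldots,y_{t-1},x_t$ of elements of $P\setminus\{x_0\}$ satisfies condition N if $y_0>x_1<y_1>x_2<\cdots<y_{t-1}>x_t$ and $y_i\not\ge x_j$ whenever $i\le j-2$. One always puts $x_0$ in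 front and sets $y_t=\infty$. It is $q^{(n)}$-reduced if $q^{(n)}\mathrm{dist}(x_i,y_j)<q^{(n)}(x_i,y_i,\ldots,x_j,y_j)$ for all $0\le i<j\le t$ with $x_i\le y_j$; the empty sequence is $q^{(n)}$-reduced. $C^{(\epsilon)}$ is the convex polytope of all $\nu:P^+\to\mathbb R$ with $\nu(\infty)=0$, $\nu(z)-\nu(z')\ge\epsilon$ whenever $z\lessdot z'$ in $P^+$, and $\nu(x_i)-\nu(y_i)=q^{(\epsilon)}\mathrm{dist}(x_i,y_i)$ for $0\le i\le t$; it is regarded as a subset of $\mathbb R^P$. For $0\le i\le t$, $G_i=\{z\in[x_i,y_i]_{P^+}\mid q^{(\epsilon)}\mathrm{dist}(x_i,z)+q^{(\epsilon)}\mathrm{dist}(z,y_i)=q^{(\epsilon)}\mathrm{dist}(x_i,y_i)\}$, and $G=G_0\cup\cdots\cup G_t$. *)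

(* Defs.v *)
From HB Require Import structures.
From mathcomp Require Import all_boot all_order all_algebra.
From mathcomp Require Import boolp classical_sets reals.

Set Implicit Arguments.
Unset Strict Implicit.
Unset Printing Implicit Defensive.

Import Order.TTheory GRing.Theory Num.Theory.

Local Open Scope order_scope.

(* Affine dimension: one less than the largest size of an affinely independent
   family of points of [C]; in particular the empty set has dimension -1. *)
Section AffineDimension.
Local Open Scope ring_scope.
Variables (K : fieldType) (V : vectType K).

Definition affinely_free (s : seq V) : bool :=
  if s is v0 :: s' then free [seq v - v0 | v <- s'] else true.

(* An affinely independent family has at most [\dim V + 1] points, so bounding
   the range of [k] loses nothing. *)
Definition affine_dim (C : set V) : int :=
  (\max_(k < (\dim {:V}).+2 |
      `[< exists s : k.-tuple V, affinely_free s /\ {in s, forall v, C v} >]) k)%N%:Z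
  - 1.

End AffineDimension.

Section SaturatedChains.
Variables (d : Order.disp_t) (T : finPOrderType d).
Implicit Types x y : T.

(* [covers x y]: [y] covers [x] *)
Definition covers : rel T :=
  fun x y => (x < y) && [forall z, ~~ ((x < z) && (z < y))].

Definition saturated_chain x y (s : seq T) : bool :=
  path covers x s && (last x s == y).

(* Lengths of the saturated chains from [x] to [y]. A chain of length [t] has
   [t.+1] distinct elements, so [t < #|T|]. *)
Definition chain_lengths x y : seq nat :=
  [seq t <- iota 0 #|T| | [exists s : t.-tuple T, saturated_chain x y s]].

(* Maximum of a nonempty sequence (the value 0 for [::] is junk). *)
Definition max_seq (l : seq int) : int :=
  if l is m :: l' then foldr Num.max m l' else 0%R.

(* For [x <= y] the set of chain lengths is nonempty, see [qdistP]. *)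
Definition qdist (n : int) x y : int :=
  max_seq [seq (n * t%:Z)%R | t <- chain_lengths x y].

(* [q^(n)(w_i, z_i, ..., w_j, z_j)] *)
Definition qalt (n : int) (w z : nat -> T) (i j : nat) : int :=
  (\sum_(i <= k < j.+1) qdist n (w k) (z k)
   - \sum_(i.+1 <= k < j.+1) qdist n (w k) (z k.-1))%R.

Lemma mem_chain_lengths x y t :
  t \in chain_lengths x y <->
  exists2 s : seq T, size s = t & saturated_chain x y s.
Proof.
rewrite mem_filter mem_iota add0n /=; split.
  by case/andP=> /existsP[s hs] _; exists s; rewrite ?size_tuple.
case=> s <- hs; apply/andP; split; first by apply/existsP; exists (in_tuple s).
have lt_xs : sorted <%O (x :: s).
  by case/andP: hs => ps _; apply: sub_path ps => a b /andP[].
have /card_uniqP/= <- : uniq (x :: s) by apply: lt_sorted_uniq.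
exact: max_card.
Qed.

Lemma exists_saturated_chain x y : x <= y -> exists s, saturated_chain x y s.
Proof.
have [n] := ubnP #|[set z | (x < z) && (z <= y)]|.
elim: n x => // n IHn x lt_n; rewrite le_eqVlt => /predU1P[->|lt_xy].
  by exists [::]; rewrite /saturated_chain /= eqxx.
pose I z := [set w | (z < w) && (w <= y)].
have Px : (fun z => (x < z) && (z <= y)) y by rewrite lt_xy lexx.
case: (@arg_maxnP _ y (fun z => (x < z) && (z <= y)) (fun z => #|I z|) Px).
move=> z /andP[lt_xz le_zy] zmax.
have cov : covers x z.
  rewrite /covers lt_xz /=; apply/forallP=> w; apply/negP=> /andP[lt_xw lt_wz].
  have := zmax w; rewrite lt_xw (le_trans (ltW lt_wz) le_zy) => /(_ isT) /=.
  rewrite leqNgt => /negP; apply; apply: proper_card; apply/fintype.properP; split.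
    apply/fintype.subsetP=> v; rewrite !inE => /andP[lt_zv ->].
    by rewrite (lt_trans lt_wz lt_zv).
  by exists z; rewrite !inE ?ltxx // lt_wz le_zy.
have [|s /andP[ps ls]] := IHn z _ le_zy.
  rewrite -ltnS; apply: leq_trans lt_n; rewrite ltnS; apply: proper_card.
  apply/fintype.properP; split.
    by apply/fintype.subsetP=> v; rewrite !inE => /andP[/(lt_trans lt_xz)-> ->].
  by exists z; rewrite !inE ?ltxx // lt_xz le_zy.
by exists (z :: s); rewrite /saturated_chain /= cov ps.
Qed.

Lemma max_seqP (l : seq int) :
  l != [::] -> max_seq l \in l /\ {in l, forall m, (m <= max_seq l)%R}.
Proof.
case: l => // m l _ /=; elim: l => [|k l [IHin IHle]] /=.
  by rewrite inE; split=> // k; rewrite inE => /eqP->.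
split.
  rewrite /Order.max; case: ifP => _; last by rewrite !inE eqxx orbT.
  by move: IHin; rewrite !inE orbCA => ->; rewrite orbT.
move=> u; rewrite !inE orbCA => /predU1P[->|hu]; first by rewrite le_max lexx.
by rewrite le_max IHle ?orbT // inE.
Qed.

Lemma qdistP (n : int) x y : x <= y ->
  (exists2 s, saturated_chain x y s & qdist n x y = (n * (size s)%:Z)%R) /\
  (forall s, saturated_chain x y s -> (n * (size s)%:Z <= qdist n x y)%R).
Proof.
move=> le_xy; have [s0 hs0] := exists_saturated_chain le_xy.
have h0 : size s0 \in chain_lengths x y.
  by apply/mem_chain_lengths; exists s0.
have [|/mapP[t /mem_chain_lengths[s <- hs] qE] qle] :=
  @max_seqP [seq (n * t%:Z)%R | t <- chain_lengths x y].
  by case: chain_lengths h0.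
split; first by exists s.
move=> u hu; apply: qle; apply/mapP; exists (size u) => //.
by apply/mem_chain_lengths; exists u.
Qed.

End SaturatedChains.

(* [T] with a greatest element [None] adjoined. *)
Definition with_top (T : Type) : Type := option T.

Section WithTop.
Variables (d : Order.disp_t) (T : finPOrderType d).

HB.instance Definition _ := Finite.on (with_top T).

Definition with_top_le : rel (with_top T) := fun x y =>
  match x, y with
  | _, None => true
  | None, Some _ => false
  | Some a, Some b => a <= b
  end.

Lemma with_top_le_refl : reflexive with_top_le.
Proof. by case=> [a|] /=. Qed.

Lemma with_top_le_anti : antisymmetric with_top_le.
Proof. by case=> [a|] [b|] //= /le_anti->. Qed.

Lemma with_top_le_trans : transitive with_top_le.
Proof. by case=> [b|] [a|] [c|] //=; apply: le_trans. Qed.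

HB.instance Definition _ := Order.Le_isPOrder.Build d (with_top T)
  with_top_le_refl with_top_le_anti with_top_le_trans.

Lemma with_top_lex1 (x : with_top T) : x <= (None : with_top T).
Proof. by case: x. Qed.

HB.instance Definition _ := Order.hasTop.Build d (with_top T) with_top_lex1.

End WithTop.

Section JoinIrreducibles.
Variables (d : Order.disp_t) (H : finTBDistrLatticeType d).

(* As in the source, the least element of [H] counts as join-irreducible. *)
Definition join_irr : pred H :=
  fun a => [forall b, forall c, (a == b `|` c) ==> (a == b) || (a == c)].

Lemma join_irr_bot : join_irr \bot.
Proof.
apply/forallP=> b; apply/forallP=> c; apply/implyP=> /eqP bot_bc.
by rewrite eq_sym -lex0 bot_bc leUl.
Qed.

Definition jirr : Type := {a : H | join_irr a}.

HB.instance Definition _ := SubFinite.on jirr.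
HB.instance Definition _ := [SubChoice_isSubPOrder of jirr by <: with d].

Lemma jirr_le0x (a : jirr) : (Sub \bot join_irr_bot : jirr) <= a.
Proof. by rewrite leEsub SubK le0x. Qed.

HB.instance Definition _ := Order.hasBottom.Build d jirr jirr_le0x.

Definition jirr_top : Type := with_top jirr.
HB.instance Definition _ := Order.FinTPOrder.on jirr_top.

Definition in_top (a : jirr) : jirr_top := Some a.

End JoinIrreducibles.

Section Sequence.
Variables (d : Order.disp_t) (H : finTBDistrLatticeType d).
Notation P := (jirr H).
Notation Pplus := (jirr_top H).

(* A sequence [y_0, x_1, y_1, ..., y_(t-1), x_t] is given by the tuples
   [ys = (y_0, ..., y_(t-1))] and [xs = (x_1, ..., x_t)]; [xseq] and [yseq] are
   the two families extended by [x_0], the least element, and [y_t = oo]. *)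
Variables (t : nat) (ys xs : t.-tuple P).

Definition xseq (i : nat) : Pplus := in_top (nth \bot (\bot :: val xs) i).
Definition yseq (i : nat) : Pplus := nth \top [seq in_top y | y <- ys] i.

Definition condN : Prop :=
  [/\ (forall i : 'I_t, tnth ys i != \bot /\ tnth xs i != \bot),
      (forall i, (i < t)%N -> xseq i.+1 < yseq i),
      (forall i, (0 < i < t)%N -> xseq i < yseq i)
    & (forall i j, (i.+2 <= j <= t)%N -> ~~ (xseq j <= yseq i))].

Definition q_reduced (n : int) : Prop :=
  forall i j, (i < j <= t)%N -> xseq i <= yseq j ->
    (qdist n (xseq i) (yseq j) < qalt n xseq yseq i j)%R.

(* [nu] on [P], extended to [P^+] by [nu oo = 0] *)
Definition extend0 (R : realType) (nu : {ffun P -> R^o}) (z : Pplus) : R :=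
  if z is Some p then nu p else 0%R.

Definition polytopeC (R : realType) (eps : int) : set {ffun P -> R^o} :=
  [set nu | (forall z z' : Pplus, covers z z' ->
               (eps%:~R <= extend0 nu z - extend0 nu z')%R) /\
            (forall i, (i <= t)%N ->
               (extend0 nu (xseq i) - extend0 nu (yseq i) =
                (qdist eps (xseq i) (yseq i))%:~R)%R)]%classic.

Definition geodesicG (eps : int) (i : nat) : {set Pplus} :=
  [set z | (xseq i <= z <= yseq i) &&
           (qdist eps (xseq i) z + qdist eps z (yseq i) ==
            qdist eps (xseq i) (yseq i))%R].

Definition unionG (eps : int) : {set Pplus} :=
  \bigcup_(i < t.+1) geodesicG eps i.

End Sequence.

Arguments polytopeC {d H t} ys xs R eps.

(* Main.v *)
Require Import Defs.
From mathcomp Require Import all_boot all_order all_algebra.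
From mathcomp Require Import boolp classical_sets reals.
From mathcomp Require Import zify ring lra.

(** Write q for the epsilon-distance, q_i for q(x_i, y_i), and call a function f
    on P^+ a potential if f z - f z' >= epsilon for every cover z < z'. Summing
    along a longest chain gives f x - f y >= q(x, y) for every x <= y.

    Upper bound. If moreover f(x_i) - f(y_i) = q_i, then all the inequalities
    along a geodesic from x_i to y_i are equalities, so f is determined on G_i
    by its value at x_i ([potential_geodesic]). Hence the difference of two
    points of C is constant on each G_i and vanishes on G_t, which contains
    infinity: it is a combination of the indicators of G_0, ..., G_(t-1) and of
    the points of P outside G. Being reduced forces the G_i to be pairwise
    disjoint ([geodesic_disjoint]), so these #(P \ G) + t indicators are
    linearly independent.

    Lower bound. It suffices to find a point of C at which every cover
    inequality not contained in a single G_i holds with a margin theta > 0: it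
    can then be moved by theta along each indicator. Prescribe first the values
    a_i at x_i and b_i = a_i - q_i at y_i. Any potential satisfies
    a_i - b_j >= q(x_i, y_j) whenever x_i <= y_j, and condition N leaves only
    j = i - 1 and j > i. Choose the a_i recursively so that the inequality for
    j = i - 1 has exactly a small positive margin. Then the one for j > i
    unfolds to
      q(x_i, y_j) + small error <= q(x_i, y_i, ..., x_j, y_j),
    which is precisely what reducedness supplies, the two integers differing by
    at least 1 ([index_potential_gap]). Finally extend to P^+ by letting f z be
    the largest value of b_j plus the weight of a saturated chain from z to
    y_j, where a cover weighs epsilon, plus theta if it is not inside one G_i
    ([exists_strict_potential]). *)

Set Implicit Arguments.
Unset Strict Implicit.
Unset Printing Implicit Defensive.

Import Order.TTheory GRing.Theory Num.Theory.

Local Open Scope order_scope.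

(** * Affine dimension *)

Section Affine.
Local Open Scope ring_scope.
Variables (K : fieldType) (V : vectType K).

(** The differences of points of C lie in the span of B, which bounds the size
    of an affinely independent family, while v0 and its translates by B attain
    that bound. *)
Lemma affine_dim_eq (C : set V) (v0 : V) (B : seq V) :
  free B -> C v0 -> {in B, forall b, C (v0 + b)} ->
  (forall u v, C u -> C v -> u - v \in <<B>>%VS) ->
  affine_dim C = (size B)%:Z.
Proof.
move=> freeB C0 CB CW; rewrite /affine_dim.
have ltB : ((size B).+1 < (\dim {:V}).+2)%N.
  by rewrite !ltnS -(eqP freeB) dimvS // subvf.
set m := (\max_(k < _ | _) _)%N.
suff -> : m = (size B).+1 by rewrite -addn1 PoszD addrK.
apply/eqP; rewrite eqn_leq; apply/andP; split.
  apply/bigmax_leqP=> k /asboolP[s [frs sC]].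
  rewrite -(size_tuple s); case: s frs sC => -[|v s'] //= sz fs sC.
  rewrite ltnS -(size_map (fun u => u - v)) -(eqP fs) -(eqP freeB).
  apply: dimvS; apply/span_subvP=> _ /mapP[u us ->].
  by apply: CW; apply: sC; rewrite in_cons ?us ?eqxx ?orbT.
apply: (@leq_bigmax_cond _ _ (fun k : 'I__ => nat_of_ord k) (Ordinal ltB)).
apply/asboolP.
have sz : size (v0 :: [seq v0 + b | b <- B]) == (size B).+1 by rewrite /= size_map.
exists (Tuple sz); split=> /=.
  rewrite -map_comp (@eq_map _ _ _ id) ?map_id // => b /=.
  by rewrite addrAC subrr add0r.
by move=> v; rewrite inE => /predU1P[->//|/mapP[b bB ->]]; apply: CB.
Qed.

End Affine.

(** * Saturated chains, geodesics and potentials *)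

Section Chains.
Variables (d : Order.disp_t) (T : finPOrderType d) (n : int).
Implicit Types x y z : T.

Lemma saturated_chain_cat x y z s1 s2 :
  saturated_chain x y s1 -> saturated_chain y z s2 ->
  saturated_chain x z (s1 ++ s2).
Proof.
move=> /andP[p1 /eqP l1] /andP[p2 l2]; rewrite /saturated_chain.
by rewrite cat_path last_cat l1 p1 p2.
Qed.

Lemma saturated_chain_split x y s z :
  saturated_chain x y s -> z \in x :: s ->
  exists s1 s2, [/\ s = s1 ++ s2, saturated_chain x z s1
                  & saturated_chain z y s2].
Proof.
move=> /andP[ps ls] zs.
move: ps ls; case/splitPl: zs => s1 s2 l1; rewrite cat_path last_cat l1.
by case/andP=> p1 p2 l2; exists s1, s2; rewrite /saturated_chain p1 p2 l1 eqxx.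
Qed.

Lemma saturated_chain_sorted x y s :
  saturated_chain x y s -> sorted <%O (x :: s).
Proof. by case/andP=> ps _; apply: sub_path ps => a b /andP[]. Qed.

Lemma saturated_chain_le x y s : saturated_chain x y s -> x <= y.
Proof.
move=> sc; have := saturated_chain_sorted sc; case/andP: sc => _ /eqP<- /=.
rewrite lt_path_sortedE => /andP[/allP xs _].
by have := mem_last x s; rewrite inE => /predU1P[->//|/xs/ltW].
Qed.

Lemma size_saturated_chain x y s : saturated_chain x y s -> (size s < #|T|)%N.
Proof.
move/saturated_chain_sorted/lt_sorted_uniq/card_uniqP => /= <-.
exact: max_card.
Qed.

Local Open Scope ring_scope.

Lemma qdist_id x : qdist n x x = 0.
Proof.
have [[s sc ->] _] := qdistP n (lexx x).
have := saturated_chain_sorted sc; case/andP: sc.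
case: s => [|u s] ps ls; first by rewrite mulr0.
rewrite [sorted _ _]lt_path_sortedE => /andP[/allP xs _].
by have := mem_last u s; move: ls => /= /eqP-> /xs; rewrite ltxx.
Qed.

Lemma qdist_triangle x z y :
  (x <= z)%O -> (z <= y)%O -> qdist n x z + qdist n z y <= qdist n x y.
Proof.
move=> xz zy.
have [[s1 c1 ->] _] := qdistP n xz; have [[s2 c2 ->] _] := qdistP n zy.
have [_ /(_ _ (saturated_chain_cat c1 c2))] := qdistP n (le_trans xz zy).
by rewrite size_cat PoszD mulrDr.
Qed.

(** The union of the chains from x to y realizing the distance; for the pair
    (x_i, y_i) it is convertible to [geodesicG]. *)
Definition geodesic x y : {set T} :=
  [set z | (x <= z <= y)%O && (qdist n x z + qdist n z y == qdist n x y)].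

Lemma geodesic_left x y : (x <= y)%O -> x \in geodesic x y.
Proof. by move=> xy; rewrite inE lexx xy qdist_id add0r eqxx. Qed.

Lemma geodesic_right x y : (x <= y)%O -> y \in geodesic x y.
Proof. by move=> xy; rewrite inE lexx xy qdist_id addr0 eqxx. Qed.

(** Cutting the chain at z gives two chains whose weights add up to q(x, y);
    neither can exceed the distance between its endpoints, so the triangle
    inequality through z is an equality. *)
Lemma longest_chain_geodesic x y s :
  saturated_chain x y s -> n * (size s)%:Z = qdist n x y ->
  {subset x :: s <= geodesic x y}.
Proof.
move=> sc sE z /(saturated_chain_split sc)[s1 [s2 [Es c1 c2]]].
have [xz zy] := (saturated_chain_le c1, saturated_chain_le c2).
rewrite inE xz zy /= eq_le qdist_triangle //= -sE Es size_cat PoszD mulrDr.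
by apply: lerD; [apply: (qdistP n xz).2|apply: (qdistP n zy).2].
Qed.

Section Potential.
Variables (R : realDomainType) (f : T -> R).
Hypothesis f_cover : forall z z', covers z z' -> n%:~R <= f z - f z'.

Lemma potential_ge x y : (x <= y)%O -> (qdist n x y)%:~R <= f x - f y.
Proof.
move=> xy; have [[s sc ->] _] := qdistP n xy.
elim: s x {xy} sc => [|u s IHs] x /andP[/=].
  by move=> _ /eqP->; rewrite mulr0 subrr.
case/andP=> xu ps ls; have := IHs u; rewrite /saturated_chain ps ls => /(_ isT).
move: (f_cover xu); rewrite -addn1 PoszD mulrDr mulr1 intrD; lra.
Qed.

(** f drops by at least q(x, z) and then by at least q(z, y), while the total
    drop is only the sum of these two bounds. *)
Lemma potential_geodesic x y z :
  f x - f y = (qdist n x y)%:~R -> z \in geodesic x y ->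
  f z = f x - (qdist n x z)%:~R.
Proof.
move=> fxy; rewrite inE => /andP[/andP[xz zy] /eqP qE].
move: (potential_ge xz) (potential_ge zy) fxy.
rewrite -qE intrD; lra.
Qed.

End Potential.

Section Loose.
Variable loose : rel T.

(** The covers selected by [loose] are those that will receive a margin. *)
Definition nb_loose x s : nat := count id (pairmap loose x s).

Lemma nb_loose_le x s : (nb_loose x s <= size s)%N.
Proof. by rewrite /nb_loose -(size_pairmap loose x) count_size. Qed.

Lemma nb_loose_cat x s1 s2 :
  nb_loose x (s1 ++ s2) = (nb_loose x s1 + nb_loose (last x s1) s2)%N.
Proof. by rewrite /nb_loose pairmap_cat count_cat. Qed.

Lemma nb_loose0 (A : {set T}) x s :
  {in A &, forall u v, ~~ loose u v} -> {subset x :: s <= A} ->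
  nb_loose x s = 0.
Proof.
move=> tA; elim: s x => //= u s IHs x sA; rewrite /nb_loose /=.
have xA : x \in A by apply: sA; rewrite inE eqxx.
have uA : u \in A by apply: sA; rewrite !inE eqxx orbT.
rewrite (negPf (tA _ _ xA uA)) add0n; apply: IHs => v vs.
by apply: sA; rewrite inE vs orbT.
Qed.

End Loose.

(** * A potential strict outside the geodesics of a reduced sequence *)

Section Reduced.
Variables (t : nat) (x y : nat -> T).
Hypothesis le_xy : forall i, (i <= t)%N -> (x i <= y i)%O.
Hypothesis far : forall i j, (i.+2 <= j <= t)%N -> ~~ (x j <= y i)%O.
Hypothesis reduced : forall i j, (i < j <= t)%N -> (x i <= y j)%O ->
  qdist n (x i) (y j) < qalt n x y i j.

Let G i := geodesic (x i) (y i).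

(** A common point z of G_i and G_j with i < j gives x_j <= y_i, so j = i + 1 by
    condition N. Recombining the halves of both geodesics at z yields
      q(x_i, y_j) + q(x_j, y_i) >= q_i + q_j,
    against reducedness at (i, j). *)
Lemma geodesic_disjoint i j z :
  (i <= t)%N -> (j <= t)%N -> z \in G i -> z \in G j -> i = j.
Proof.
wlog: i j / (i <= j)%N => [wl it jt zi zj|].
  by case/orP: (leq_total i j) => ij; [|apply/esym]; apply: wl.
rewrite leq_eqVlt => /predU1P[//|ij] it jt.
rewrite !inE => /andP[/andP[xiz zyi] /eqP qi] /andP[/andP[xjz zyj] /eqP qj].
have [ji|] := leqP j i.+1; last first.
  by move=> ltj; have := @far i j; rewrite ltj jt (le_trans xjz zyi) => /(_ isT).
have {ij ji} Ej : j = i.+1 by apply/eqP; rewrite eqn_leq ji ij.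
rewrite {}Ej in xjz zyj qj jt *.
have := @reduced i i.+1; rewrite leqnn jt (le_trans xiz zyj) => /(_ isT isT).
rewrite /qalt big_nat_recr //= big_nat1 big_nat1 /=.
move: (qdist_triangle xiz zyj) (qdist_triangle xjz zyi).
rewrite -qi -qj; lia.
Qed.

Variables (R : realFieldType).

Definition loose : rel T :=
  fun z z' => ~~ [exists i : 'I_t.+1, (z \in G i) && (z' \in G i)].

(* A chain has fewer than N covers, so its margins contribute at most
   [delta * N]; the choice of [delta] makes up to t + 1 such contributions
   together at most 1, the gap between distinct integers. *)
Let N : R := #|T|%:R.
Let delta : R := (N * t.+1%:R)^-1.

(* The values prescribed at x_i and y_i: the increment of [a] is the one that
   gives a_(k+1) - b_k = q(x_(k+1), y_k) + delta * N. *)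
Let a i : R :=
  \sum_(0 <= k < i) ((qdist n (x k.+1) (y k) - qdist n (x k) (y k))%:~R
                     + delta * N).
Let b i : R := a i - (qdist n (x i) (y i))%:~R.

Let card_gt0 : 0 < N.
Proof. by rewrite ltr0n; apply/card_gt0P; exists (x 0). Qed.

Let delta_gt0 : 0 < delta.
Proof. by rewrite invr_gt0 mulr_gt0 // ltr0n. Qed.

Let deltaN : delta * N = t.+1%:R^-1.
Proof. by rewrite /delta invfM mulrAC mulVf ?mul1r // lt0r_neq0. Qed.

(** Equality holds for j = i - 1. For j > i the sum defining a_j - a_i
    telescopes the alternating sum q(x_i, y_i, ..., x_j, y_j), with j - i margins
    [delta * N]; one more is claimed, and reducedness leaves room for t + 1. *)
Lemma index_potential_gap i j : (i <= t)%N -> (j <= t)%N -> i != j ->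
  (x i <= y j)%O -> (qdist n (x i) (y j))%:~R + delta * N <= a i - b j.
Proof.
move=> it jt nij xy; rewrite /b; case: (ltngtP i j) nij => // ij _.
  have := @reduced i j; rewrite ij jt xy => /(_ isT isT).
  rewrite /qalt big_nat_recr 1?ltnW //= big_add1 /=.
  set A := \sum_(i <= k < j) qdist n (x k) (y k).
  set B := \sum_(i <= k < j) qdist n (x k.+1) (y k).
  have -> : a j = a i + ((B - A)%:~R + delta * N *+ (j - i)).
    rewrite {1}/a (@big_cat_nat _ _ _ i 0 j) // 1?ltnW // -/(a i) big_split.
    by rewrite -rmorph_sum sumrB sumr_const_nat.
  rewrite -lezD1 => h.
  have {h} : (qdist n (x i) (y j) + 1)%:~R
               <= (A + qdist n (x j) (y j) - B)%:~R :> R by rewrite ler_int.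
  have : delta * N * (j - i).+1%:R <= 1.
    rewrite deltaN mulrC ler_pdivrMr ?ltr0n // mul1r ler_nat; lia.
  rewrite -addn1 natrD mulrDr mulr_natr !rmorphB !rmorphD /=; lra.
have [ji|] := leqP i j.+1; last first.
  by move=> lti; have := @far j i; rewrite lti it xy => /(_ isT).
have {ij ji} Ei : i = j.+1 by apply/eqP; rewrite eqn_leq ji ij.
rewrite {}Ei /a big_nat_recr //= rmorphB /=; lra.
Qed.

(* The weight of the chain [s] starting at [z]. *)
Let wt z s : R := n%:~R * (size s)%:R + delta * (nb_loose loose z s)%:R.

Let wt_cat z s1 s2 : wt z (s1 ++ s2) = wt z s1 + wt (last z s1) s2.
Proof. rewrite /wt size_cat nb_loose_cat !natrD; ring. Qed.

Let wt_longest i s : (i <= t)%N -> saturated_chain (x i) (y i) s ->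
  n * (size s)%:Z = qdist n (x i) (y i) -> wt (x i) s = (qdist n (x i) (y i))%:~R.
Proof.
move=> it sc qE; rewrite /wt (@nb_loose0 _ (G i)) ?mulr0 ?addr0 -?qE ?intrM //.
  move=> u v uG vG; rewrite negbK; apply/existsP.
  by exists (Ordinal (it : (i < t.+1)%N)); rewrite uG vG.
exact: longest_chain_geodesic.
Qed.

(* For i = j, a chain that is not longest loses at least 1, more than its
   margins can bring; a longest one has no margin by [wt_longest]. *)
Let wt_chain i j s : (i <= t)%N -> (j <= t)%N ->
  saturated_chain (x i) (y j) s -> wt (x i) s + b j <= a i.
Proof.
move=> it jt sc; have xy := saturated_chain_le sc.
have sq : n * (size s)%:Z <= qdist n (x i) (y j) by apply: (qdistP n xy).2.
have nb : delta * (nb_loose loose (x i) s)%:R <= delta * N.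
  rewrite ler_pM2l // ler_nat (leq_trans (nb_loose_le _ _ _)) //.
  exact: ltnW (size_saturated_chain sc).
have [Eij|nij] := eqVneq i j.
  rewrite -Eij {j jt Eij xy} in sc sq *.
  move: sq; rewrite le_eqVlt => /predU1P[qE|].
    by rewrite wt_longest // /b subrKC.
  rewrite -lezD1 -(ler_int R) intrD intrM /b /wt.
  have : delta * N <= 1 by rewrite deltaN invf_le1 ?ltr0n // ler1n.
  move: nb; lra.
have := index_potential_gap it jt nij xy.
by move: sq; rewrite -(ler_int R) intrM /wt; move: nb; lra.
Qed.

(** A longest-path construction: f z is the maximum of wt z s + b_j over the
    saturated chains s from z to some y_j. Prepending a cover to a chain gives
    the cover inequalities. The gap lemma makes a_i the value at x_i; prepending
    a longest chain from x_i to y_i transfers this to the value b_i at y_i. *)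
Lemma exists_strict_potential : (forall z, (z <= y t)%O) ->
  exists2 theta : R, 0 < theta & exists f : T -> R,
    (forall z z', covers z z' -> n%:~R + theta * (loose z z')%:R <= f z - f z') /\
    (forall i, (i <= t)%N -> f (x i) - f (y i) = (qdist n (x i) (y i))%:~R).
Proof.
move=> yt; exists delta => //.
have /boolp.choice[f fP] : forall z, exists m : R,
    (forall j s, (j <= t)%N -> saturated_chain z (y j) s -> wt z s + b j <= m) /\
    (exists j s, [/\ (j <= t)%N, saturated_chain z (y j) s & m = wt z s + b j]).
  move=> z.
  have [s0 sc0] := exists_saturated_chain (yt z).
  have bs s y0 : saturated_chain z y0 s -> (size s <= #|T|)%N.
    by move=> /size_saturated_chain/ltnW.
  (* Bounding the size of the chains makes the maximum range over a finite type. *)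
  pose S := ('I_t.+1 * #|T|.-bseq T)%type.
  pose ok := [pred js : S | saturated_chain z (y js.1) js.2].
  pose val (js : S) := wt z js.2 + b js.1.
  have ok0 : ok (ord_max, Bseq (bs _ _ sc0)) by [].
  case: (arg_maxP val ok0) => -[j s] /= okjs jsmax; exists (val (j, s)); split.
    move=> k u kt uk; exact: (jsmax (Ordinal (kt : (k < t.+1)%N), Bseq (bs _ _ uk))).
  by exists j, s; rewrite -ltnS ltn_ord.
have fx i : (i <= t)%N -> f (x i) = a i.
  move=> it; apply/le_anti/andP; split.
    by have [_ [j [s [jt sc ->]]]] := fP (x i); apply: wt_chain.
  have [[s sc qE] _] := qdistP n (le_xy it).
  have [/(_ i s it sc) + _] := fP (x i).
  by rewrite wt_longest // /b subrKC.
have fy i : (i <= t)%N -> f (y i) = b i.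
  move=> it; apply/le_anti/andP; split.
    have [_ [j [s [jt sc ->]]]] := fP (y i).
    have [[s0 sc0 qE] _] := qdistP n (le_xy it).
    have := wt_chain it jt (saturated_chain_cat sc0 sc).
    rewrite wt_cat wt_longest //; case/andP: sc0 => _ /eqP->; rewrite {3}/b; lra.
  have [/(_ i [::] it) + _] := fP (y i).
  by rewrite /saturated_chain /wt /= eqxx !mulr0 addr0 add0r; apply.
exists f; split=> [z z' zz'|i it]; last by rewrite fx // fy // /b; ring.
have [_ [j [s [jt sc ->]]]] := fP z'.
have /(fP z).1 : saturated_chain z (y j) (z' :: s).
  by move: sc; rewrite /saturated_chain /= zz'.
move=> /(_ jt); rewrite -cat1s wt_cat /= {1}/wt /nb_loose /= addn0; lra.
Qed.

End Reduced.
End Chains.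

(** * Indicators of a disjoint family *)

Section Indicators.
Local Open Scope ring_scope.
Variables (K : fieldType) (P I : finType) (B : I -> {set P}) (rep : I -> P).
Variable theta : K.
Hypothesis theta_neq0 : theta != 0.
Hypothesis rep_in : forall c, rep c \in B c.
Hypothesis B_disjoint : forall c c' p, p \in B c -> p \in B c' -> c = c'.

Definition indicator (c : I) : {ffun P -> K^o} :=
  [ffun p => theta * (p \in B c)%:R].

Lemma sum_indicator (k : I -> K) c p :
  p \in B c -> (\sum_c' k c' *: indicator c') p = k c * theta.
Proof.
move=> pc; rewrite sum_ffunE (bigD1 c) //= big1 => [|c' nc].
  by rewrite !ffunE pc mulr1 addr0.
rewrite !ffunE; case: (boolP (p \in B c')) => [pc'|_]; last first.
  by rewrite mulr0 scaler0.
by rewrite (B_disjoint pc' pc) eqxx in nc.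
Qed.

Definition indicators : #|I|.-tuple {ffun P -> K^o} :=
  [tuple indicator (enum_val i) | i < #|I|].

Lemma sum_indicators (k : I -> K) :
  \sum_(i < #|I|) k (enum_val i) *: indicators`_i = \sum_c k c *: indicator c.
Proof.
rewrite [RHS](reindex (fun i : 'I_#|I| => enum_val i)) /=; last first.
  exact/onW_bij/enum_val_bij.
by apply: eq_bigr => i _; rewrite nth_mktuple.
Qed.

Lemma free_indicators : free indicators.
Proof.
apply/freeP=> k k0 i; pose l c := k (enum_rank c).
have: (\sum_c l c *: indicator c) (rep (enum_val i)) = 0.
  rewrite -sum_indicators /l; under eq_bigr do rewrite enum_valK.
  by rewrite k0 ffunE.
rewrite (sum_indicator _ (rep_in _)) /l enum_valK => /eqP.
by rewrite mulf_eq0 (negPf theta_neq0) orbF => /eqP.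
Qed.

Lemma indicators_span (f : {ffun P -> K^o}) :
  (forall c p, p \in B c -> f p = f (rep c)) ->
  (forall p, (forall c, p \notin B c) -> f p = 0) ->
  f \in <<indicators>>%VS.
Proof.
move=> fB f0; pose k c : K := f (rep c) / theta.
suff -> : f = \sum_(i < #|I|) k (enum_val i) *: indicators`_i.
  apply: memv_suml => i _; apply/memvZ/memv_span.
  by apply: mem_nth; rewrite size_tuple.
rewrite sum_indicators; apply/ffunP => p.
have [c pc|np] := pickP (fun c => p \in B c).
  by rewrite (sum_indicator _ pc) /k divfK // (fB _ _ pc).
rewrite f0 => [|c]; last by rewrite np.
by rewrite sum_ffunE big1 // => c _; rewrite !ffunE np mulr0 scaler0.
Qed.

End Indicators.

(** * The polytope C *)

Section Polytope.
Local Open Scope ring_scope.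
Variables (R : realType) (d : Order.disp_t) (H : finTBDistrLatticeType d).
Variables (eps : int) (t : nat) (ys xs : t.-tuple (jirr H)).
Hypothesis cN : condN ys xs.
Hypothesis red : q_reduced ys xs eps.

Let x := xseq xs.
Let y := yseq ys.
Let G i := geodesic eps (x i) (y i).

Lemma yseq_top : y t = \top%O.
Proof. by rewrite /y /yseq nth_default // size_map size_tuple. Qed.

Lemma xseq_le_yseq i : (i <= t)%N -> (x i <= y i)%O.
Proof.
case: cN => _ _ lt_xy _; rewrite leq_eqVlt => /predU1P[->|it].
  by rewrite yseq_top lex1.
case: i it => [|i] it; last exact/ltW/lt_xy.
rewrite /y /yseq (nth_map \bot%O) ?size_tuple //; exact: le0x.
Qed.

Let disjG i j z : (i <= t)%N -> (j <= t)%N -> z \in G i -> z \in G j -> i = j.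
Proof. by case: cN => _ _ _ far; apply: (geodesic_disjoint far red). Qed.

Let top_G : \top%O \in G t.
Proof. by rewrite -yseq_top; apply/geodesic_right/xseq_le_yseq. Qed.

Let outside : {set jirr H} := [set p | in_top p \notin unionG ys xs eps].

(** The classes on which the differences of points of C are constant; G_t, where
    they vanish, is left out. *)
Definition block (c : {p | p \in outside} + 'I_t) : {set jirr H} :=
  match c with
  | inl p => [set val p]
  | inr i => [set q | in_top q \in G i]
  end.

Definition block_rep (c : {p | p \in outside} + 'I_t) : jirr H :=
  match c with
  | inl p => val p
  | inr i => nth \bot%O (\bot%O :: val xs) i
  end.

Lemma in_block c p :
  (p \in block c) =
  match c with inl q => p == val q | inr i => in_top p \in G i end.
Proof. by case: c => c; rewrite /= ?finset.in_set1 ?finset.in_set. Qed.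

Lemma block_rep_in c : block_rep c \in block c.
Proof.
case: c => [p|i]; rewrite in_block //=.
exact/geodesic_left/xseq_le_yseq/ltnW/ltn_ord.
Qed.

Lemma notin_outside p i : p \in outside -> (i <= t)%N -> in_top p \notin G i.
Proof.
rewrite inE => pU it; apply: contra pU => pG.
by apply/bigcupP; exists (Ordinal (it : (i < t.+1)%N)).
Qed.

Lemma block_disjoint c c' p : p \in block c -> p \in block c' -> c = c'.
Proof.
have out (q : {p | p \in outside}) (i : 'I_t) : in_top (val q) \notin G i.
  exact: notin_outside (valP q) (ltnW (ltn_ord i)).
rewrite !in_block; case: c c' => [q|i] [q'|i'].
- by move=> /eqP-> /eqP/val_inj->.
- by move=> /eqP->; rewrite (negPf (out _ _)).
- by move=> + /eqP E; rewrite E (negPf (out _ _)).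
- move=> pi pi'; congr inr; apply/val_inj.
  exact: disjG (ltnW (ltn_ord i)) (ltnW (ltn_ord i')) pi pi'.
Qed.

(* The indicator of a block, extended to P^+ as [extend0] does. *)
Let chi c (z : jirr_top H) : bool := if z is Some p then p \in block c else false.

(** The indicator of a block is constant on each G_i. For the value at infinity,
    note that infinity lies in G_t only. *)
Lemma block_geodesic c z i : (i <= t)%N -> z \in G i ->
  chi c z = if c is inr j then (j : nat) == i else false.
Proof.
move=> it zG; case: c => [p|j].
  case: z zG => //= q qG; rewrite finset.in_set1; apply/negP=> /eqP Eq.
  by move: qG; rewrite Eq (negPf (notin_outside (valP p) it)).
have jt := ltnW (ltn_ord j); apply/idP/eqP => [|Ej].
  by case: z zG => //= q qG; rewrite finset.in_set => qj; apply: disjG qj qG.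
rewrite -Ej in zG; case: z zG => [q|]; first by rewrite [chi _ _]in_block.
move=> topG; have := ltn_ord j; rewrite (disjG jt (leqnn t) topG top_G).
by rewrite ltnn.
Qed.

Lemma extend0D (u v : {ffun jirr H -> R^o}) z :
  extend0 (u + v) z = extend0 u z + extend0 v z.
Proof. by case: z => [p|] /=; rewrite ?ffunE ?addr0. Qed.

Lemma extend0_indicator (theta : R) c z :
  extend0 (indicator block theta c) z = theta * (chi c z)%:R.
Proof. by case: z => [p|] /=; rewrite ?ffunE ?mulr0. Qed.

Lemma polytope_geodesic (u : {ffun jirr H -> R^o}) i z :
  polytopeC ys xs R eps u -> (i <= t)%N -> z \in G i ->
  extend0 u z = extend0 u (x i) - (qdist eps (x i) z)%:~R.
Proof. by case=> cov eq_xy it; apply: potential_geodesic => //; apply: eq_xy. Qed.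

Lemma polytope_diff (u v : {ffun jirr H -> R^o}) i z z' :
  polytopeC ys xs R eps u -> polytopeC ys xs R eps v ->
  (i <= t)%N -> z \in G i -> z' \in G i ->
  extend0 u z - extend0 v z = extend0 u z' - extend0 v z'.
Proof.
move=> uC vC it zG zG'.
rewrite (polytope_geodesic uC it zG) (polytope_geodesic uC it zG').
by rewrite (polytope_geodesic vC it zG) (polytope_geodesic vC it zG'); ring.
Qed.

(** The base point is a strict potential shifted to vanish at infinity; moving it
    by theta along an indicator uses at most the margin theta of a cover outside
    the G_i and leaves the differences inside a G_i unchanged. *)
Lemma dim_polytope :
  affine_dim (polytopeC ys xs R eps) = (#|outside| + t)%N%:Z.
Proof.
have [_ _ _ far] := cN.
have [|theta theta_gt0 [f [fcov feq]]] := exists_strict_potential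
  xseq_le_yseq far red R.
  by move=> z; rewrite -/y yseq_top lex1.
pose v0 : {ffun jirr H -> R^o} := [ffun p => f (in_top p) - f \top%O].
have v0E z : extend0 v0 z = f z - f \top%O.
  by case: z => [p|] /=; rewrite ?ffunE ?subrr.
pose B := indicators block theta.
rewrite (@affine_dim_eq _ _ _ v0 B).
- by rewrite size_tuple card_sum card_ord card_sig.
- apply: free_indicators block_rep_in block_disjoint; exact: lt0r_neq0.
- split=> [z z' zz'|i it]; rewrite !v0E opprB subrKA.
    apply: le_trans (fcov _ _ zz'); rewrite lerDl mulr_ge0 ?ler0n //.
    exact: ltW.
  exact: feq.
- move=> _ /mapP[i _ ->]; set c := enum_val i.
  split=> [z z' zz'|j jt]; rewrite !extend0D !extend0_indicator !v0E.
    have := fcov _ _ zz'; rewrite /loose.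
    case: existsP => [[k /andP[zk z'k]]|_] /=.
      have kt : (k <= t)%N by rewrite -ltnS.
      have -> : chi c z = chi c z'.
        by rewrite (block_geodesic _ kt zk) (block_geodesic _ kt z'k).
      lra.
    by case: (chi c z); case: (chi c z'); move: theta_gt0 => /=; lra.
  rewrite (block_geodesic _ jt (geodesic_left eps (xseq_le_yseq jt))).
  rewrite (block_geodesic _ jt (geodesic_right eps (xseq_le_yseq jt))).
  by rewrite -(feq _ jt); ring.
move=> u v uC vC; apply: (indicators_span (rep := block_rep) (lt0r_neq0 theta_gt0)).
- exact: block_disjoint.
- move=> [p|i] q; rewrite in_block; first by move/eqP->.
  have it := ltnW (ltn_ord i).
  move=> qG; rewrite !ffunE.
  exact: polytope_diff uC vC it qG (geodesic_left eps (xseq_le_yseq it)).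
- move=> p np; rewrite !ffunE.
  have /bigcupP[i _ pG] : in_top p \in unionG ys xs eps.
    apply/negPn/negP => pU.
    have pO : p \in outside by rewrite inE.
    by have := np (inl (exist _ p pO)); rewrite in_block eqxx.
  have Ei : i = t :> nat.
    apply/eqP; rewrite eqn_leq -ltnS ltn_ord /= leqNgt; apply/negP => it.
    by have := np (inr (Ordinal it)); rewrite in_block pG.
  rewrite Ei in pG; rewrite [LHS](polytope_diff uC vC (leqnn t) pG top_G).
  by rewrite /= subrr.
Qed.

End Polytope.

Theorem theorem4p6 (R : realType) (d : Order.disp_t)
    (H : finTBDistrLatticeType d) (eps : int) (t : nat)
    (ys xs : t.-tuple (jirr H)) :
  eps = 1%R \/ eps = (-1)%R ->
  condN ys xs ->
  q_reduced ys xs eps ->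
  affine_dim (polytopeC ys xs R eps) =
    (#|[set p : jirr H | in_top p \notin unionG ys xs eps]| + t)%N%:Z%R.
Proof. by move=> _; apply: dim_polytope. Qed.
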